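(* For $\mathbf{x}\in\mathbb{R}^{3(m+n)}$, the linear programming problem defined by $$\Gamma^\star(\mathbf{x}):=\operatorname*{argmax}_{\boldsymbol{\gamma}\in\Gamma}\Psi(\mathbf{x},\boldsymbol{\gamma})$$ satisfies $\Gamma^\star(\mathbf{x})\subseteq\Sigma$, i.e. every assignment $\boldsymbol{\gamma}^\star\in\Gamma^\star(\mathbf{x})$ is a feasible assignment. Starting from some $\mathbf{x}\in\mathbb{R}^{3(m+n)}$, if $L>L^\star(\mathbf{x})$, then every optimal assignment $\boldsymbol{\gamma}^\star\in\Gamma^\star(\mathbf{x})$ ensures that the least number of evaders reach the target, i.e. $m_{\boldsymbol{\gamma}^\star}\le m_{\boldsymbol{\mu}}$ for all $\boldsymbol{\mu}\in\Sigma$.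
   Context: There are $m$ evaders $E_i$, $i\in M=\{1,\dots,m\}$, and $n$ pursuers $P_j$, $j\in N=\{1,\dots,n\}$, with positions $\mathbf{x}_{E_i},\mathbf{x}_{P_j}\in\mathbb{R}^3$, constant speeds $U_i,V_j>0$, and speed ratios $\alpha_{ij}=U_i/V_j$; the state is $\mathbf{x}=(\mathbf{x}_{E_1},\dots,\mathbf{x}_{E_m},\mathbf{x}_{P_1},\dots,\mathbf{x}_{P_n})\in\mathbb{R}^{3(m+n)}$. The evaders aim to reach the target, which is the origin; the pursuers aim to prevent this. Standing assumption: each pursuer can capture at most one evader and each evader is pursued by one pursuer, $n\ge m$, and pursuers commit to their assignments throughout the game. Let $\mathbf{1}_k$ be the all-ones column vector of size $k$ (vector inequalities are entrywise). Feasible assignments: $\Sigma=\{\boldsymbol{\mu}\in\{0,1\}^{m\times n}:\boldsymbol{\mu}\mathbf{1}_n=\mathbf{1}_m,\ \boldsymbol{\mu}^T\mathbf{1}_m\le\mathbf{1}_n\}$. Probabilistic feasible assignments: $\Gamma=\{\boldsymbol{\gamma}\in[0,1]^{m\times n}:\boldsymbol{\gamma}\mathbf{1}_n=\mathbf{1}_m,\ \boldsymbol{\gamma}^T\mathbf{1}_m\le\mathbf{1}_n\}$. $B_{ij}(\mathbf{x}_{E_i},\mathbf{x}_{P_j})=\|\mathbf{x}_{E_i}\|^2-\alpha_{ij}^2\|\mathbf{x}_{P_j}\|^2$. When $B_{ij}>0$ and $\alpha_{ij}<1$, $\mathcal{V}^P_{ij}=\Big\|\frac{\mathbf{x}_{E_i}-\alpha_{ij}^2\mathbf{x}_{P_j}}{1-\alpha_{ij}^2}\Big\|-\frac{\alpha_{ij}}{1-\alpha_{ij}^2}\|\mathbf{x}_{P_j}-\mathbf{x}_{E_i}\|$;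 when $B_{ij}>0$ and $\alpha_{ij}=1$, $\mathcal{V}^P_{ij}=\frac{\|\mathbf{x}_{E_i}\|^2-\|\mathbf{x}_{P_j}\|^2}{2\|\mathbf{x}_{E_i}-\mathbf{x}_{P_j}\|}$ (in both cases $\mathcal{V}^P_{ij}>0$). Payoffs, with a cost parameter $L>0$: $a_{ij}(\mathbf{x}_{E_i},\mathbf{x}_{P_j})=\mathcal{V}^P_{ij}(\mathbf{x}_{E_i},\mathbf{x}_{P_j})$ if $B_{ij}>0$ and $\alpha_{ij}\le 1$, and $a_{ij}=-L$ otherwise. Team payoff: $\Psi(\mathbf{x},\boldsymbol{\gamma})=\sum_{i\in M}\sum_{j\in N}a_{ij}(\mathbf{x}_{E_i},\mathbf{x}_{P_j})\gamma_{ij}$. For $\boldsymbol{\mu}\in\Sigma$: $A_{\boldsymbol{\mu}}=\{ij\in M\times N:\mu_{ij}=1\}$, $A_{\boldsymbol{\mu}}^W=\{ij\in A_{\boldsymbol{\mu}}:a_{ij}>0\}$ (pairings where the pursuer wins), $A_{\boldsymbol{\mu}}^L=A_{\boldsymbol{\mu}}\setminus A_{\boldsymbol{\mu}}^W$ (pairings where the pursuer loses, the evader being counted as reaching the target). The number of evaders reaching the target under $\boldsymbol{\mu}$ is $m_{\boldsymbol{\mu}}=|A_{\boldsymbol{\mu}}^L|$. $L^\star(\mathbf{x})=\sum_{i\in M}\max_{j\in\hat{N}_i}\mathcal{V}^P_{ij}(\mathbf{x}_{E_i},\mathbf{x}_{P_j})$, where $\hat{N}_i=\{j\in N:B_{ij}(\mathbf{x}_{E_i},\mathbf{x}_{P_j})>0,\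 \alpha_{ij}\le1\}$ and a maximum over the empty set is $0$.
   Formalization: Γ*⊆Σ fails under ties (m=1, n=2, both pursuers losing: (1/2,1/2) is optimal), so it is replaced by: Γ* is nonempty, its extreme points lie in Σ, and Γ* is the convex hull of Γ*∩Σ. For fractional γ*, m_γ* counts only losing pairs with γ*_ij=1. *)

(* Defs.v *)
From HB Require Import structures.
From mathcomp Require Import all_boot all_order all_algebra.
From mathcomp Require Import all_classical all_reals.

Set Implicit Arguments.
Unset Strict Implicit.
Unset Printing Implicit Defensive.

Import Order.TTheory GRing.Theory Num.Theory.

Local Open Scope classical_set_scope.
Local Open Scope ring_scope.

(* The norm that MathComp-Analysis puts on 'rV[R]_d is the sup norm. *)
Definition enorm (R : realType) (d : nat) (v : 'rV[R]_d) : R :=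
  Num.sqrt (\sum_(k < d) v ord0 k ^+ 2).

Definition conv (R : realType) (E : lmodType R) (S : set E) : set E :=
  [set x | exists (k : nat) (p : 'I_k -> E) (w : 'I_k -> R),
     [/\ forall l, S (p l), forall l, 0 <= w l, \sum_l w l = 1
       & x = \sum_l w l *: p l]].

Definition extreme_points (R : realType) (E : lmodType R) (S : set E) : set E :=
  [set x | S x /\ forall (y z : E) (t : R), S y -> S z -> 0 < t < 1 ->
     x = t *: y + (1 - t) *: z -> y = x /\ z = x].

(* R^(3(m+n)): the evaders' positions, then the pursuers' positions. *)
Definition state (R : realType) (m n : nat) : Type :=
  (('I_m -> 'rV[R]_3) * ('I_n -> 'rV[R]_3))%type.

Definition Sigma (R : realType) (m n : nat) : set 'M[R]_(m, n) :=
  [set mu : 'M[R]_(m, n) | [/\ forall i j, mu i j = 0 \/ mu i j = 1,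
     mu *m const_mx 1 = const_mx 1 :> 'cV[R]_m
   & forall j, (mu^T *m const_mx 1 : 'cV[R]_n) j ord0 <= 1]].

Definition Gamma (R : realType) (m n : nat) : set 'M[R]_(m, n) :=
  [set g : 'M[R]_(m, n) | [/\ forall i j, 0 <= g i j <= 1,
     g *m const_mx 1 = const_mx 1 :> 'cV[R]_m
   & forall j, (g^T *m const_mx 1 : 'cV[R]_n) j ord0 <= 1]].

Arguments Sigma {R m n}.
Arguments Gamma {R m n}.

(* In B, VP and pay, [a] is a speed ratio, [xE] an evader, [xP] a pursuer. *)
Definition B (R : realType) (a : R) (xE xP : 'rV[R]_3) : R :=
  enorm xE ^+ 2 - a ^+ 2 * enorm xP ^+ 2.

(* Only meaningful when 0 < B a xE xP and a <= 1, so that the last branch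
   is the case a = 1; it is used only under these conditions. *)
Definition VP (R : realType) (a : R) (xE xP : 'rV[R]_3) : R :=
  if a < 1 then
    enorm ((1 - a ^+ 2)^-1 *: (xE - a ^+ 2 *: xP))
      - a / (1 - a ^+ 2) * enorm (xP - xE)
  else (enorm xE ^+ 2 - enorm xP ^+ 2) / (2 * enorm (xE - xP)).

Definition pay (R : realType) (L a : R) (xE xP : 'rV[R]_3) : R :=
  if (0 < B a xE xP) && (a <= 1) then VP a xE xP else - L.

Section Game.
Variables (R : realType) (m n : nat) (U : 'I_m -> R) (V : 'I_n -> R).
Implicit Types (L : R) (x : state R m n) (g mu : 'M[R]_(m, n)).

Definition alpha (i : 'I_m) (j : 'I_n) : R := U i / V j.

Definition payoff L x (i : 'I_m) (j : 'I_n) : R :=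
  pay L (alpha i j) (x.1 i) (x.2 j).

Definition Psi L x g : R := \sum_(i < m) \sum_(j < n) payoff L x i j * g i j.

Definition Gamma_star L x : set 'M[R]_(m, n) :=
  [set g : 'M[R]_(m, n) | Gamma g /\ forall g', Gamma g' -> Psi L x g' <= Psi L x g].

Definition pairings mu : {set 'I_m * 'I_n} :=
  [set ij : 'I_m * 'I_n | mu ij.1 ij.2 == 1]%SET.

Definition winning L x mu : {set 'I_m * 'I_n} :=
  [set ij in pairings mu | 0 < payoff L x ij.1 ij.2]%SET.

Definition losing L x mu : {set 'I_m * 'I_n} :=
  (pairings mu :\: winning L x mu)%SET.

Definition num_reaching L x mu : nat := #|losing L x mu|.

(* VP is positive on the range of the maximum, so starting it from 0 only
   affects the empty maximum. *)
Definition L_star x : R :=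
  \sum_(i < m) \big[Num.max/0]_(j < n |
      (0 < B (alpha i j) (x.1 i) (x.2 j)) && (alpha i j <= 1))
    VP (alpha i j) (x.1 i) (x.2 j).

End Game.

(* Main.v *)
From HB Require Import structures.
From mathcomp Require Import all_boot all_order all_algebra.
From mathcomp Require Import all_classical all_reals.
From mathcomp Require Import ring lra zify.
Require Import Defs.

Set Implicit Arguments.
Unset Strict Implicit.
Unset Printing Implicit Defensive.

Import Order.TTheory GRing.Theory Num.Theory.

Local Open Scope classical_set_scope.
Local Open Scope ring_scope.

(** The optimal set of a linear programme is a face of its feasible set, and
the feasible set [Gamma] is the convex hull of the assignments [Sigma]; both
structural claims follow from these two facts.

If [x] maximises a linear form over [conv S], every point of positive weight
in a representation of [x] over [S] must be a maximiser too, so the maximisers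
are the hull of the maximisers in [S] ([argmax_conv]); and the extreme points
of a hull lie in the set that generates it ([extreme_points_conv]).

That [Gamma] is the hull of [Sigma] ([Gamma_conv_Sigma]) is a rectangular
Birkhoff-von Neumann theorem.  Adding one slack row turns the column
inequalities into equalities and leaves all row sums integral, so it suffices
to treat matrices in [0, 1] with integral margins ([transport_sub_conv]).  For
these, the fractional entries, read as edges between rows and columns, form a
bipartite graph without vertex of degree one, because an integral sum cannot
contain exactly one fractional term.  Such a graph carries a nonzero
circulation, by a count of equations against unknowns ([circulation]).  Moving
the matrix along the circulation, forwards and backwards, until an entry
becomes 0 or 1 writes it as a convex combination of two matrices with the same
margins and fewer fractional entries.

The bound on the number of evaders reaching the target compares two
estimates.  An optimal [g] has payoff at most [L_star - L * num_reaching g]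
([Psi_le]), even when it is fractional, and an assignment [mu] has payoff at
least [- L * num_reaching mu] ([Psi_ge]), because the value of a game that the
pursuer can win is positive ([VP_gt0]).  Optimality of [g] then gives
[L * (num_reaching g - num_reaching mu) <= L_star < L], and the difference of
the two counts is an integer smaller than 1. *)

(** * Linear maximisation over convex hulls *)

Section ConvexHull.
Variables (R : realType) (E : lmodType R).
Implicit Types (S T : set E) (f : {scalar E}).

Definition argmax S f : set E := [set x | S x /\ forall y, S y -> f y <= f x].

Lemma sub_conv S : S `<=` conv S.
Proof.
move=> x Sx; exists 1%N, (fun=> x), (fun=> 1); split=> //.
by rewrite big_ord1.
by rewrite big_ord1 scale1r.
Qed.

Lemma conv_segment S (t : R) x y :
  0 <= t <= 1 -> conv S x -> conv S y -> conv S (t *: x + (1 - t) *: y).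
Proof.
move=> /andP[t0 t1] [k [p [w [Sp w0 w1 ->]]]] [k' [p' [w' [Sp' w'0 w'1 ->]]]].
exists (k + k')%N,
  (fun l => match fintype.split l with inl i => p i | inr i => p' i end),
  (fun l => match fintype.split l with inl i => t * w i | inr i => (1 - t) * w' i end).
split.
- by move=> l; case: (fintype.split l).
- by move=> l; case: (fintype.split l) => i; rewrite mulr_ge0 // subr_ge0.
- rewrite big_split_ord /=.
  under eq_bigr do rewrite (unsplitK (inl _)).
  under [X in _ + X]eq_bigr do rewrite (unsplitK (inr _)).
  by rewrite -!mulr_sumr w1 w'1; ring.
- rewrite big_split_ord /= !scaler_sumr; congr (_ + _); apply: eq_bigr => i _.
    by rewrite (unsplitK (inl _)) scalerA.
  by rewrite (unsplitK (inr _)) scalerA.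
Qed.

Lemma weight_gt0 k (w : 'I_k -> R) :
  (forall l, 0 <= w l) -> \sum_l w l = 1 -> exists l, 0 < w l.
Proof.
move=> w0 w1; have [||l] := @psumr_neq0P R _ xpredT w; first by [].
  by rewrite w1; apply/eqP/oner_neq0.
by exists l.
Qed.

(** If [x = \sum_l w l *: p l] is extreme and [w l] is positive, [x] lies
strictly between [p l] and another point of the hull, hence equals [p l]. *)
Lemma extreme_points_conv S : extreme_points (conv S) `<=` S.
Proof.
move=> x [[k [p [w [Sp w0 w1 xE]]]] xext].
have [l wl] := weight_gt0 w0 w1.
have wl1 : w l <= 1.
  by rewrite -w1 (bigD1 l) //= lerDl sumr_ge0.
(* Half of the weight of [p l] is split off, rather than all of it, so that
   the remaining weight [1 - t] is nonzero even when [w l = 1]. *)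
set t := w l / 2.
have t01 : 0 < t < 1 by rewrite /t; lra.
have t1 : 0 < 1 - t by lra.
set v := fun h => (w h - (if h == l then t else 0)) / (1 - t).
have vsum : \sum_h v h = 1.
  by rewrite -mulr_suml sumrB w1 -big_mkcond big_pred1_eq divff // gt_eqF.
have cy : conv S (\sum_h v h *: p h).
  exists k, p, v; split=> // h; rewrite /v divr_ge0 ?(ltW t1) //.
  by case: eqP => [->|_]; [rewrite /t; lra | rewrite subr0].
have [|<- _ //] := xext (p l) _ t (sub_conv (Sp l)) cy t01.
rewrite scaler_sumr (bigD1 l) //= addrA xE (bigD1 l) //=; congr (_ + _).
  rewrite /v eqxx scalerA mulrC divfK ?gt_eqF // -scalerDl.
  by congr (_ *: _); ring.
apply: eq_bigr => h /negPf hl; rewrite /v hl subr0 scalerA mulrC divfK //.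
by rewrite gt_eqF.
Qed.

Lemma argmax_sub_argmax_conv S f : argmax S f `<=` argmax (conv S) f.
Proof.
move=> x [Sx xmax]; split; first exact: sub_conv.
move=> _ [k [p [w [Sp w0 w1 ->]]]].
rewrite linear_sum -[leRHS]mul1r -w1 mulr_suml; apply: ler_sum => l _.
by rewrite linearZ ler_wpM2l // xmax.
Qed.

(** A weighted mean of values that do not exceed [f x] equals [f x] only if
every value of positive weight equals [f x]. *)
Lemma argmax_conv S f : argmax (conv S) f = conv (argmax (conv S) f `&` S).
Proof.
apply/seteqP; split=> x.
  move=> [[k [p [w [Sp w0 w1 xE]]]] xmax].
  have fp l : 0 < w l -> f (p l) = f x.
    move=> wl; have H : \sum_l w l * (f x - f (p l)) = 0.
      under eq_bigr do rewrite mulrBr.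
      rewrite sumrB -mulr_suml w1 mul1r {1}xE linear_sum.
      by under eq_bigr do rewrite linearZ /=; rewrite subrr.
    have := psumr_eq0P _ H => /(_ _ l isT) /eqP.
    rewrite mulf_eq0 gt_eqF //= => H0; apply/esym/eqP; rewrite -subr_eq0; apply: H0.
    by move=> h _; rewrite mulr_ge0 // subr_ge0; apply/xmax/sub_conv.
  have [l0 wl0] := weight_gt0 w0 w1.
  (* A point of weight zero need not be a maximiser; replacing it by [p l0]
     does not change the combination. *)
  exists k, (fun l => if 0 < w l then p l else p l0), w; split=> //.
    move=> l; have [l' [-> wl']] :
        exists l', (if 0 < w l then p l else p l0) = p l' /\ 0 < w l'.
      by case: ifP => wl; [exists l | exists l0].
    split; last exact: Sp.
    by split; [exact: sub_conv | move=> y Sy; rewrite fp //; exact: xmax].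
  rewrite xE; apply: eq_bigr => l _; case: ifPn => //.
  by rewrite lt_def w0 andbT negbK => /eqP ->; rewrite !scale0r.
move=> [k [p [w [Ap w0 w1 ->]]]]; split.
  by exists k, p, w; split=> // l; have [] := Ap l.
move=> y Sy; rewrite linear_sum -[f y]mul1r -w1 mulr_suml; apply: ler_sum => l _.
by rewrite linearZ ler_wpM2l //; have [[_ ->]] := Ap l.
Qed.

End ConvexHull.

(** * Circulations in bipartite graphs *)

Section Circulation.
Variables (K : fieldType) (S : finType).
Implicit Types F : {set S}.

(** A homogeneous linear system with fewer equations than unknowns has a
nonzero solution.  Unknowns and equations are indexed by subsets of arbitrary
finite types, so that no enumeration of edges or vertices is needed later. *)
Lemma linear_relation (C : finType) F (T : {set C}) (a : S -> C -> K) :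
  (#|T| < #|F|)%N ->
  exists u : S -> K, [/\ exists s, u s != 0, forall s, s \notin F -> u s = 0
    & forall c, c \in T -> \sum_s u s * a s c = 0].
Proof.
move=> TF.
have [s0 s0F] : exists s0, s0 \in F by apply/card_gt0P/(leq_ltn_trans _ TF).
pose A := \matrix_(h < #|F|, k < #|T|) a (enum_val h) (enum_val k).
have : kermx A != 0.
  by rewrite kermx_eq0 /row_free neq_ltn (leq_ltn_trans (rank_leq_col A) TF).
case/rowV0Pn=> v /sub_kermxP vA v0.
exists (fun s => if s \in F then v ord0 (enum_rank_in s0F s) else 0); split.
- case/rV0Pn: v0 => h vh; exists (enum_val h).
  by rewrite enum_valP enum_valK_in.
- by move=> s /negPf ->.
move=> c cT; move/matrixP/(_ ord0 (enum_rank_in cT c)): vA.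
rewrite !mxE; apply: etrans.
rewrite (bigID (mem F)) /= [X in _ + X]big1 ?addr0; last first.
  by move=> s /negPf ->; rewrite mul0r.
rewrite big_enum_val; apply: eq_bigr => h _.
by rewrite enum_valP enum_valK_in mxE enum_rankK_in.
Qed.

Lemma leq_double_card_imset (C : finType) F (f : S -> C) :
  (forall s, s \in F -> exists s', [/\ s' \in F, s' != s & f s' = f s]) ->
  (#|f @: F|.*2 <= #|F|)%N.
Proof.
move=> H; rewrite -[#|F|]sum1_card (partition_big f (mem (f @: F))) /=; last first.
  by move=> s sF; exact: imset_f.
rewrite -muln2 -sum_nat_const; apply: leq_sum => _ /imsetP[s sF ->].
have [s' [s'F s's fs']] := H s sF.
by rewrite (bigD1 s) ?sF ?eqxx //= (bigD1 s') ?s'F ?fs' ?eqxx.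
Qed.

(** [F] is a set of edges with end points given by [f] and [g], and every end
point of an edge of [F] is an end point of a second one.  There are then at
least as many edges as vertices.  The vertex equations are dependent, since
the equations on either side add up to the total of [u]; so the equation at
one vertex can be dropped, which leaves fewer equations than edges. *)
Lemma circulation (A B : finType) F (f : S -> A) (g : S -> B) :
  F != finset.set0 ->
  (forall s, s \in F -> exists s', [/\ s' \in F, s' != s & f s' = f s]) ->
  (forall s, s \in F -> exists s', [/\ s' \in F, s' != s & g s' = g s]) ->
  exists u : S -> K, [/\ exists s, u s != 0, forall s, s \notin F -> u s = 0,
    forall a, \sum_(s | f s == a) u s = 0 & forall b, \sum_(s | g s == b) u s = 0].
Proof.
move=> /set0Pn[s0 s0F] Hf Hg.
pose T := ([set inl a | a in (f @: F) :\ f s0] :|: [set inr b | b in g @: F])%SET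
  : {set A + B}.
have TF : (#|T| < #|F|)%N.
  have Tle : (#|T| <= #|(f @: F) :\ f s0| + #|g @: F|)%N.
    by rewrite (leq_trans (finset.leq_card_setU _ _)) // leq_add // leq_imset_card.
  have fE := cardsD1 (f s0) (f @: F); rewrite imset_f // in fE.
  have arith (t a' a b k : nat) : (t <= a' + b -> a = 1 + a' ->
    a.*2 <= k -> b.*2 <= k -> t < k)%N by lia.
  exact: arith Tle fE (leq_double_card_imset Hf) (leq_double_card_imset Hg).
have [u [u0 uF uT]] := linear_relation
  (fun s c => match c with inl a => (f s == a)%:R | inr b => (g s == b)%:R end) TF.
have supp (C : finType) (h : S -> C) c : c \notin h @: F -> \sum_(s | h s == c) u s = 0.
  move=> cF; apply: big1 => s /eqP hs; apply: uF; apply: contra cF => sF.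
  by rewrite -hs imset_f.
have ug b : \sum_(s | g s == b) u s = 0.
  case: (boolP (b \in g @: F)) => [bF|/supp //].
  have := uT (inr b); rewrite inE (imset_f inr bF) orbT => /(_ isT) uT0; rewrite -[RHS]uT0.
  by rewrite big_mkcond; apply: eq_bigr => s _; case: eqP; rewrite ?mulr1 ?mulr0.
have uf a : a != f s0 -> \sum_(s | f s == a) u s = 0.
  move=> as0; case: (boolP (a \in f @: F)) => [aF|/supp //].
  have := uT (inl a); rewrite inE (imset_f inl) ?inE ?as0 //= => /(_ isT) uT0; rewrite -[RHS]uT0.
  by rewrite big_mkcond; apply: eq_bigr => s _; case: eqP; rewrite ?mulr1 ?mulr0.
exists u; split=> // a; have [->|/uf //] := eqVneq a (f s0).
(* The equation dropped at [f s0] follows from all the others. *)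
have total : \sum_s u s = 0.
  by rewrite (partition_big g xpredT) //= big1.
move: total; rewrite (partition_big f xpredT) //= (bigD1 (f s0)) //=.
by rewrite [X in _ + X]big1 ?addr0 // => a' /uf.
Qed.

End Circulation.

(** * Matrices with integral margins *)

Section Transportation.
Variables (R : realType) (p q : nat).
Implicit Types (g d : 'M[R]_(p, q)) (r : 'I_p -> R) (c : 'I_q -> R).

Definition transport r c : set 'M[R]_(p, q) :=
  [set g | [/\ forall i j, 0 <= g i j <= 1,
     forall i, \sum_j g i j = r i & forall j, \sum_i g i j = c j]].

Definition binary : set 'M[R]_(p, q) :=
  [set g | forall i j, g i j = 0 \/ g i j = 1].

Definition fractional g : {set 'I_p * 'I_q} :=
  [set ij | 0 < g ij.1 ij.2 < 1]%SET.

Lemma other_fractional (I : finType) (v : I -> R) k :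
  (forall i, 0 <= v i <= 1) -> \sum_i v i \is a Num.int -> 0 < v k < 1 ->
  exists2 k', k' != k & 0 < v k' < 1.
Proof.
move=> v01 vint vk; apply: contrapT => H.
suff : v k \is a Num.int.
  by case/intrP=> z vz; move: vk; rewrite vz ltr0z ltrz1; lia.
have -> : v k = \sum_i v i - \sum_(i | i != k) v i by rewrite (bigD1 k) //= addrK.
rewrite rpredB //; apply: rpred_sum => i ik.
have [|v0] := boolP (0 < v i); last first.
  have /eqP -> : v i == 0 by rewrite eq_le (andP (v01 i)).1 andbT leNgt.
  exact: rpred0.
have [vi1 vi0|v1 _] := boolP (v i < 1).
  by case: H; exists i => //; rewrite vi0.
have /eqP -> : v i == 1 by rewrite eq_le (andP (v01 i)).2 leNgt.
exact: rpred1.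
Qed.

(** The entries of a row add up to an integer, so a row with a fractional
entry has a second one, and likewise for columns. *)
Lemma fractional_circulation r c g :
  (forall i, r i \is a Num.int) -> (forall j, c j \is a Num.int) ->
  transport r c g -> fractional g != finset.set0 ->
  exists d, [/\ exists i j, d i j != 0,
    forall i j, (i, j) \notin fractional g -> d i j = 0,
    forall i, \sum_j d i j = 0 & forall j, \sum_i d i j = 0].
Proof.
move=> rint cint [g01 gr gc] gF.
have [||u [[[i0 j0] u0] uF u1 u2]] := circulation R (f := fst) (g := snd) gF.
- move=> [i j]; rewrite inE /= => gij.
  have [||j' j'j gij'] := @other_fractional _ (g i) j _ _ gij => //.
    by rewrite gr.
  by exists (i, j'); rewrite inE /= xpair_eqE eqxx.
- move=> [i j]; rewrite inE /= => gij.
  have [||i' i'i gij'] := @other_fractional _ (g^~ j) i _ _ gij => //.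
    by rewrite gc.
  by exists (i', j); rewrite inE /= xpair_eqE eqxx andbT.
exists (\matrix_(i, j) u (i, j)); split.
- by exists i0, j0; rewrite mxE.
- by move=> i j ijF; rewrite mxE uF.
- move=> i; rewrite -[RHS](u1 i).
  rewrite (reindex_onto (pair i) snd) /=; last by case=> i' j /= /eqP ->.
  by apply: eq_big => [j|j _]; rewrite ?eqxx ?mxE.
- move=> j; rewrite -[RHS](u2 j).
  rewrite (reindex_onto (fun i => (i, j)) fst) /=; last by case=> i' j' /= /eqP ->.
  by apply: eq_big => [i|i _]; rewrite ?eqxx ?mxE.
Qed.

(** Here [t] is the largest step along [d] that keeps all entries in [0, 1]:
the minimum over the support of [d] of the distance to the bound ahead,
divided by the speed.  The entry attaining the minimum ends up at 0 or 1, and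
integral entries do not move. *)
Lemma round_one_entry r c g d :
  transport r c g -> (exists i j, d i j != 0) ->
  (forall i j, (i, j) \notin fractional g -> d i j = 0) ->
  (forall i, \sum_j d i j = 0) -> (forall j, \sum_i d i j = 0) ->
  exists2 t : R, 0 < t & transport r c (g + t *: d) /\
    (#|fractional (g + t *: d)| < #|fractional g|)%N.
Proof.
move=> [g01 gr gc] [i0 [j0 d0]] dF dr dc.
pose slack (ij : 'I_p * 'I_q) := if 0 < d ij.1 ij.2
  then (1 - g ij.1 ij.2) / d ij.1 ij.2 else g ij.1 ij.2 / - d ij.1 ij.2.
have [[i1 j1] /= d1 minslack] : exists2 s, d s.1 s.2 != 0 &
    forall s', d s'.1 s'.2 != 0 -> slack s <= slack s'.
  have [s ds smin] := @arg_minP _ _ _ (i0, j0) (fun s => d s.1 s.2 != 0) slack d0.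
  by exists s.
have frac i j : d i j != 0 -> 0 < g i j < 1.
  move=> dij; have : (i, j) \in fractional g.
    by apply: contraNT dij => /dF ->.
  by rewrite inE.
have dlt0 i j : d i j != 0 -> ~~ (0 < d i j) -> 0 < - d i j.
  by move=> dij; rewrite oppr_gt0 -leNgt lt_neqAle dij.
set t := slack (i1, j1).
have t0 : 0 < t.
  have /andP[g0 g1] := frac _ _ d1; rewrite /t /slack /=.
  by case: ifPn => dij; rewrite divr_gt0 ?subr_gt0 // dlt0.
exists t => //; split; first split.
- move=> i j; rewrite !mxE; have [->|dij] := eqVneq (d i j) 0.
    by rewrite mulr0 addr0.
  have := minslack (i, j) dij; rewrite -/t {1}/slack /=.
  have /andP[g0 g1] := frac _ _ dij.
  case: ifPn => [dpos|/(dlt0 _ _ dij) dneg].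
    rewrite ler_pdivlMr // => tle.
    have := mulr_gt0 t0 dpos; lra.
  rewrite ler_pdivlMr // mulrN => tle.
  have := mulr_gt0 t0 dneg; rewrite mulrN; lra.
- move=> i; under eq_bigr do rewrite !mxE.
  by rewrite big_split /= -mulr_sumr dr mulr0 addr0.
- move=> j; under eq_bigr do rewrite !mxE.
  by rewrite big_split /= -mulr_sumr dc mulr0 addr0.
apply/proper_card/properP; split.
  apply/fintype.subsetP => -[i j]; apply: contraTT => ijF.
  by move: (ijF); rewrite !inE /= !mxE dF // mulr0 addr0.
exists (i1, j1); first by rewrite inE; exact: frac.
rewrite inE /= !mxE /t /slack /=; case: ifPn => [dpos|dneg].
  by rewrite divfK // subrKC ltxx andbF.
by rewrite invrN mulrN mulNr divfK // subrr ltxx.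
Qed.

(** Induction on the number of fractional entries: [g] lies on the segment
between the two points where the line through [g] along a circulation [d]
leaves the unit cube. *)
Lemma transport_sub_conv r c :
  (forall i, r i \is a Num.int) -> (forall j, c j \is a Num.int) ->
  transport r c `<=` conv (transport r c `&` binary).
Proof.
move=> rint cint g; move: {2}#|_|.+1 (ltnSn #|fractional g|) => k.
elim: k g => // k IHk g; rewrite ltnS => gk gT.
have [F0|F0] := eqVneq (fractional g) finset.set0.
  apply: sub_conv; split=> // i j; have [/(_ i j)/andP[g0 g1] _ _] := gT.
  have := finset.in_set0 (i, j); rewrite -F0 inE /= !lt_neqAle g0 g1 !andbT.
  by rewrite eq_sym; have [|] := eqVneq (g i j) 0; [left | right; exact/eqP/negbNE/negbT].
have [d [d0 dF dr dc]] := fractional_circulation rint cint gT F0.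
have [t t0 [tT tk]] := round_one_entry gT d0 dF dr dc.
have [||||t' t'0 [t'T t'k]] := round_one_entry (d := - d) gT.
- by case: d0 => i [j dij]; exists i, j; rewrite mxE oppr_eq0.
- by move=> i j /dF dij; rewrite mxE dij oppr0.
- by move=> i; under eq_bigr do rewrite mxE; rewrite sumrN dr oppr0.
- by move=> j; under eq_bigr do rewrite mxE; rewrite sumrN dc oppr0.
have tt' : t + t' != 0 by rewrite gt_eqF // addr_gt0.
have -> : g = (t' / (t + t')) *: (g + t *: d) + (1 - t' / (t + t')) *: (g + t' *: - d).
  by apply/matrixP => i j; rewrite !mxE; field.
apply: conv_segment.
- apply/andP; split; first by rewrite divr_ge0 // ltW // addr_gt0.
  by rewrite ler_pdivrMr ?addr_gt0 // mul1r lerDr ltW.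
- by apply: IHk => //; exact: leq_trans gk.
- by apply: IHk => //; exact: leq_trans gk.
Qed.

End Transportation.

(** * Probabilistic assignments as mixtures of assignments *)

Section Assignments.
Variables (R : realType) (m n : nat).
Implicit Types g mu : 'M[R]_(m, n).

Lemma mulmx_ones (p q : nat) (g : 'M[R]_(p, q)) i :
  (g *m const_mx 1 : 'cV[R]_p) i ord0 = \sum_j g i j.
Proof. by rewrite mxE; apply: eq_bigr => j _; rewrite mxE mulr1. Qed.

Lemma mulmx_ones_eq g :
  (g *m const_mx 1 = const_mx 1 :> 'cV[R]_m) <-> forall i, \sum_j g i j = 1.
Proof.
split=> [gE i|gE]; first by rewrite -mulmx_ones gE mxE.
by apply/matrixP => i k; rewrite ord1 mulmx_ones gE mxE.
Qed.

Lemma trmx_mulmx_ones g j :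
  (g^T *m const_mx 1 : 'cV[R]_n) j ord0 = \sum_i g i j.
Proof. by rewrite mulmx_ones; apply: eq_bigr => i _; rewrite mxE. Qed.

(** The slack row holds the probability that a pursuer stays idle.  Its sum is
[n - m], so all margins of the extended matrix are integral. *)
Lemma Gamma_sub_conv : (Gamma : set 'M[R]_(m, n)) `<=` conv Sigma.
Proof.
move=> g [g01 /mulmx_ones_eq gr gc].
pose slack := \row_j (1 - \sum_i g i j).
pose gs := col_mx g slack.
have gsr i : \sum_j gs i j \is a Num.int.
  rewrite -(splitK i); case: (fintype.split i) => {}i /=.
    by under eq_bigr do rewrite col_mxEu; rewrite gr rpred1.
  under eq_bigr do rewrite col_mxEd mxE.
  rewrite sumrB exchange_big /=; under [X in _ - X]eq_bigr do rewrite gr.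
  by rewrite !sumr_const rpredB // rpredMn // rpred1.
have gsT : transport (fun i => \sum_j gs i j) (fun=> 1) gs.
  split=> // [i j|j].
    rewrite -(splitK i); case: (fintype.split i) => {}i /=.
      by rewrite col_mxEu.
    rewrite col_mxEd mxE subr_ge0 -trmx_mulmx_ones gc gerBl trmx_mulmx_ones.
    by apply: sumr_ge0 => k _; have /andP[] := g01 k j.
  rewrite big_split_ord /= big_ord1 col_mxEd mxE.
  by under eq_bigr do rewrite col_mxEu; rewrite addrC subrK.
have [k [p [w [Sp w0 w1 gsE]]]] := transport_sub_conv gsr (fun=> rpred1 _) gsT.
exists k, (fun l => usubmx (p l)), w; split=> //; last first.
  rewrite -[g](col_mxKu g slack) -/gs gsE linear_sum.
  by apply: eq_bigr => l _; rewrite linearZ.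
move=> l; have [[p01 pr pc] pbin] := Sp l; split.
- by move=> i j; rewrite mxE; exact: pbin.
- apply/mulmx_ones_eq => i; under eq_bigr do rewrite mxE.
  by rewrite pr; under eq_bigr do rewrite col_mxEu; rewrite gr.
move=> j; rewrite trmx_mulmx_ones -(pc j) big_split_ord /=.
under eq_bigr do rewrite mxE; rewrite lerDl.
by apply: sumr_ge0 => i _; have /andP[] := p01 (rshift m i) j.
Qed.

Lemma Gamma_conv_Sigma : Gamma = conv (Sigma : set 'M[R]_(m, n)).
Proof.
apply/seteqP; split; first exact: Gamma_sub_conv.
move=> g [k [p [w [Sp w0 w1 ->]]]].
have wE i j : (\sum_l w l *: p l) i j = \sum_l w l * p l i j.
  by rewrite summxE; apply: eq_bigr => l _; rewrite mxE.
have p01 l i j : 0 <= p l i j <= 1.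
  by have [/(_ i j)[] -> _ _] := Sp l; rewrite ?lexx ler01.
have avg_le1 (v : 'I_k -> R) : (forall l, v l <= 1) -> \sum_l w l * v l <= 1.
  by move=> v1; rewrite -w1; apply: ler_sum => l _; exact: ler_piMr.
split.
- move=> i j; rewrite wE avg_le1 ?andbT; last by move=> l; have /andP[] := p01 l i j.
  by apply: sumr_ge0 => l _; rewrite mulr_ge0 //; have /andP[] := p01 l i j.
- apply/mulmx_ones_eq => i; under eq_bigr do rewrite wE.
  rewrite exchange_big /= -[RHS]w1; apply: eq_bigr => l _.
  by have [_ /mulmx_ones_eq pr _] := Sp l; rewrite -mulr_sumr pr mulr1.
- move=> j; rewrite trmx_mulmx_ones; under eq_bigr do rewrite wE.
  rewrite exchange_big /=; under eq_bigr do rewrite -mulr_sumr.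
  by apply: avg_le1 => l; have [_ _ /(_ j)] := Sp l; rewrite trmx_mulmx_ones.
Qed.

Lemma Sigma_nonempty : (m <= n)%N -> (Sigma : set 'M[R]_(m, n)) !=set0.
Proof.
move=> mn; exists (\matrix_(i, j) (j == widen_ord mn i)%:R); split.
- by move=> i j; rewrite mxE; case: (_ == _); [right | left].
- apply/mulmx_ones_eq => i; rewrite (bigD1 (widen_ord mn i)) //= mxE eqxx.
  by rewrite big1 ?addr0 // => j /negPf ji; rewrite mxE ji.
move=> j; rewrite trmx_mulmx_ones.
have [[i ij]|H] := pselect (exists i, j = widen_ord mn i).
  rewrite (bigD1 i) //= mxE ij eqxx big1 ?addr0 // => i' /negPf i'i.
  by rewrite mxE -val_eqE /= eq_sym val_eqE i'i.
rewrite big1 ?ler01 // => i _; rewrite mxE.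
by case: eqP => // ij; case: H; exists i.
Qed.

(** [Sigma] is in bijection with a subset of the finite type of boolean
matrices. *)
Lemma argmax_Sigma_nonempty (f : {scalar 'M[R]_(m, n)}) : (m <= n)%N ->
  argmax Sigma f !=set0.
Proof.
move=> /Sigma_nonempty[mu0 Smu0].
pose real_of (b : 'M[bool]_(m, n)) : 'M[R]_(m, n) := map_mx (fun e : bool => e%:R) b.
have boolE mu : Sigma mu -> mu = real_of (map_mx (fun e => e == 1) mu).
  case=> mu01 _ _; apply/matrixP => i j; rewrite !mxE.
  by case: (mu01 i j) => ->; rewrite ?eqxx // eq_sym oner_eq0.
have P0 : `[< Sigma (real_of (map_mx (fun e => e == 1) mu0)) >].
  by apply/asboolP; rewrite -boolE.
have [b /asboolP Sb bmax] := @arg_maxP _ _ _ _ (fun b => `[< Sigma (real_of b) >])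
  (fun b => f (real_of b)) P0.
exists (real_of b); split=> // mu Smu; rewrite (boolE _ Smu); apply: bmax.
by apply/asboolP; rewrite -boolE.
Qed.

End Assignments.

(** * Positivity of the value of a won game *)

Section Value.
Variable R : realType.
Implicit Types (v xE xP : 'rV[R]_3) (a L : R).

Lemma enorm_ge0 d (v : 'rV[R]_d) : 0 <= enorm v.
Proof. exact: sqrtr_ge0. Qed.

Lemma enorm_sqr d (v : 'rV[R]_d) : enorm v ^+ 2 = \sum_k v ord0 k ^+ 2.
Proof. by rewrite sqr_sqrtr // sumr_ge0 // => k _; exact: sqr_ge0. Qed.

Lemma enorm_gt0 d (v : 'rV[R]_d) : v != 0 -> 0 < enorm v.
Proof.
move=> v0; rewrite sqrtr_gt0 lt_def sumr_ge0 ?andbT => [|k _]; last exact: sqr_ge0.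
apply: contra v0 => /eqP v0; apply/eqP/rowP => k; rewrite mxE.
have := psumr_eq0P _ v0 => /(_ (fun i _ => sqr_ge0 _) k isT) /eqP.
by rewrite sqrf_eq0 => /eqP.
Qed.

(** For [a < 1], with [c = 1 - a ^+ 2], comparing squares reduces the claim to
the identity
[enorm (xE - a ^+ 2 *: xP) ^+ 2 - a ^+ 2 * enorm (xP - xE) ^+ 2 = c * B a xE xP].
For [a = 1] the numerator is [B 1 xE xP], whose positivity also forces
[xE != xP]. *)
Lemma VP_gt0 a xE xP : 0 < a -> a <= 1 -> 0 < B a xE xP -> 0 < VP a xE xP.
Proof.
move=> a0 a1; rewrite /B /VP; case: ifPn => [alt|age] Bpos.
  have c0 : 0 < 1 - a ^+ 2 by nra.
  rewrite subr_gt0 -(ltr_pXn2r (n := 2)) ?nnegrE ?enorm_ge0 //; last first.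
    by rewrite mulr_ge0 ?enorm_ge0 // divr_ge0 // ltW.
  rewrite exprMn !enorm_sqr expr_div_n.
  have -> : \sum_k ((1 - a ^+ 2)^-1 *: (xE - a ^+ 2 *: xP)) ord0 k ^+ 2 =
      (\sum_k (xE ord0 k - a ^+ 2 * xP ord0 k) ^+ 2) / (1 - a ^+ 2) ^+ 2.
    rewrite mulr_suml; apply: eq_bigr => k _.
    by rewrite !mxE mulrC exprMn exprVn.
  rewrite mulrAC ltr_pM2r ?invr_gt0 ?exprn_gt0 // -subr_gt0 mulr_sumr -sumrB.
  have -> : \sum_i ((xE ord0 i - a ^+ 2 * xP ord0 i) ^+ 2 -
      a ^+ 2 * (xP - xE) ord0 i ^+ 2) =
      (1 - a ^+ 2) * (enorm xE ^+ 2 - a ^+ 2 * enorm xP ^+ 2).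
    rewrite !enorm_sqr mulr_sumr -sumrB mulr_sumr.
    by apply: eq_bigr => k _; rewrite !mxE; ring.
  exact: mulr_gt0.
have aE : a = 1 by apply/eqP; rewrite eq_le a1 leNgt.
move: Bpos; rewrite aE expr1n mul1r => Bpos.
rewrite divr_gt0 // mulr_gt0 // enorm_gt0 //.
by apply: contraTneq Bpos => /subr0_eq ->; rewrite subrr ltxx.
Qed.

End Value.

(** * Payoffs and the number of evaders reaching the target *)

Section Team.
Variables (R : realType) (m n : nat) (U : 'I_m -> R) (V : 'I_n -> R).
Variables (x : state R m n) (L : R).
Hypotheses (U0 : forall i, 0 < U i) (V0 : forall j, 0 < V j) (L0 : 0 < L).
Implicit Types g mu : 'M[R]_(m, n).

Lemma Psi_is_scalar : scalar (Psi U V L x).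
Proof.
move=> a g h; rewrite /Psi mulr_sumr -big_split; apply: eq_bigr => i _ /=.
rewrite mulr_sumr -big_split; apply: eq_bigr => j _ /=.
by rewrite !mxE; ring.
Qed.

HB.instance Definition _ :=
  GRing.isLinear.Build R 'M[R]_(m, n) R *%R (Psi U V L x) Psi_is_scalar.

Lemma Gamma_star_argmax : Gamma_star U V L x = argmax (conv Sigma) (Psi U V L x).
Proof. by rewrite -Gamma_conv_Sigma. Qed.

Definition can_win i j : bool :=
  (0 < B (alpha U V i j) (x.1 i) (x.2 j)) && (alpha U V i j <= 1).

(** Thus the losing pairings are exactly those that cost [L]: no pairing is
lost with a payoff other than [- L]. *)
Lemma payoff_gt0 i j : (0 < payoff U V L x i j) = can_win i j.
Proof.
rewrite /payoff /pay -/(can_win i j); case: ifPn => [/andP[Bpos a1]|_].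
  by apply: VP_gt0 => //; rewrite divr_gt0.
by rewrite oppr_gt0 ltNge ltW.
Qed.

Lemma card_losing g :
  (num_reaching U V L x g)%:R =
  \sum_i \sum_j (~~ can_win i j && (g i j == 1))%:R :> R.
Proof.
rewrite /num_reaching -sum1_card natr_sum pair_big /= big_mkcond /=.
apply: eq_bigr => -[i j] _; rewrite !inE payoff_gt0 /=.
by case: (can_win i j); case: (g i j == 1).
Qed.

(** In row [i] the winnable pairings contribute a mean of values bounded by
the [i]-th maximum in [L_star], and each hopeless pairing chosen with certainty
costs [L].  Hopeless pairings of smaller weight only lower the payoff. *)
Lemma Psi_le g : Gamma g ->
  Psi U V L x g <= L_star U V x - L * (num_reaching U V L x g)%:R.
Proof.
move=> [g01 /mulmx_ones_eq gr _].
rewrite card_losing mulr_sumr /L_star -sumrB; apply: ler_sum => i _.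
set M := \big[Num.max/_]_(_ | _) _.
have M0 : 0 <= M by exact: bigmax_ge_id.
have -> : M = \sum_j M * g i j by rewrite -mulr_sumr gr mulr1.
rewrite mulr_sumr -sumrB; apply: ler_sum => j _.
have /andP[g0 _] := g01 i j.
rewrite /payoff /pay -/(can_win i j); case: ifPn => [win|lose] /=.
  rewrite mulr0 subr0 ler_wpM2r //.
  exact: (le_bigmax_cond 0 (fun j => VP (alpha U V i j) (x.1 i) (x.2 j))).
have Mg : 0 <= M * g i j by rewrite mulr_ge0.
have Lg : 0 <= L * g i j by rewrite mulr_ge0 // ltW.
have [gij1|_] := eqVneq (g i j) 1; last by rewrite mulr0; lra.
by move: Mg; rewrite gij1 mulr1n; lra.
Qed.

Lemma Psi_ge mu : Sigma mu ->
  - (L * (num_reaching U V L x mu)%:R) <= Psi U V L x mu.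
Proof.
move=> [mu01 _ _]; rewrite card_losing mulr_sumr -sumrN; apply: ler_sum => i _.
rewrite mulr_sumr -sumrN; apply: ler_sum => j _.
have := payoff_gt0 i j; rewrite /payoff /pay -/(can_win i j).
case: ifPn => [win /ltW VP0|lose _] /=.
  by rewrite mulr0 oppr0 mulr_ge0 //; case: (mu01 i j) => ->.
by case: (mu01 i j) => ->; rewrite ?eqxx 1?eq_sym ?oner_eq0 ?mulr0 ?mulr1 ?oppr0.
Qed.

(** One more evader reaching the target costs more than all the won games
together can gain. *)
Lemma num_reaching_min g mu : L_star U V x < L -> Gamma_star U V L x g -> Sigma mu ->
  (num_reaching U V L x g <= num_reaching U V L x mu)%N.
Proof.
move=> Lbig [Gg gmax] Smu; rewrite -ltnS -(ltr_nat R) -natr1.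
have Gmu : Gamma mu by rewrite Gamma_conv_Sigma; exact: sub_conv.
rewrite -(ltr_pM2l L0) mulrDr mulr1.
have := le_trans (Psi_ge Smu) (le_trans (gmax _ Gmu) (Psi_le Gg)); lra.
Qed.

End Team.

Theorem theorem3 (R : realType) (m n : nat) (U : 'I_m -> R) (V : 'I_n -> R)
    (x : state R m n) :
  (m <= n)%N ->
  (forall i, 0 < U i) ->
  (forall j, 0 < V j) ->
  (forall L : R, 0 < L ->
     [/\ Gamma_star U V L x !=set0,
         extreme_points (Gamma_star U V L x) `<=` Sigma
       & Gamma_star U V L x = conv (Gamma_star U V L x `&` Sigma)]) /\
  (forall L : R, 0 < L -> L_star U V x < L ->
     forall g : 'M[R]_(m, n), Gamma_star U V L x g ->
     forall mu : 'M[R]_(m, n), Sigma mu ->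
       (num_reaching U V L x g <= num_reaching U V L x mu)%N).
Proof.
move=> mn U0 V0; split=> L L0; last by move=> Lbig g Gg mu; exact: num_reaching_min.
have GE : Gamma_star U V L x = conv (Gamma_star U V L x `&` Sigma).
  by rewrite Gamma_star_argmax; exact: argmax_conv.
split=> //; last first.
  by rewrite GE => g /extreme_points_conv[].
have [mu mumax] := argmax_Sigma_nonempty (Psi U V L x) mn.
by exists mu; rewrite Gamma_star_argmax; exact: argmax_sub_argmax_conv.
Qed.
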